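(* Let $R$ be a ring, and let $a,b,c\in R$. If $a(ba)^2=abaca=acaba=(ac)^2a$, then $ac\in R^{D}$ if and only if $ba\in R^{D}$. In this case, $(ba)^D=b((ac)^D)^2a$ and $(ac)^D=a((ba)^D)^2c$.
   Context: All rings are associative with an identity. For $a\in R$, $comm(a)=\{x\in R : xa=ax\}$ and $comm^2(a)=\{x\in R : xy=yx \text{ for all } y\in comm(a)\}$. $R^{nil}$ is the set of nilpotent elements of $R$. An element $a\in R$ has a Drazin inverse if there exists $b\in R$ such that $b=bab$, $b\in comm^2(a)$ and $a-a^2b\in R^{nil}$. Such a $b$ is unique if it exists and is denoted $a^D$. $R^{D}$ is the set of all elements of $R$ that have a Drazin inverse. *)

(* Defs.v *)
From mathcomp Require Import all_boot all_algebra.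
From mathcomp Require Import boolp classical_sets.

Set Implicit Arguments.
Unset Strict Implicit.
Unset Printing Implicit Defensive.

Import GRing.Theory.
Local Open Scope classical_set_scope.
Local Open Scope ring_scope.

(* pzRingType: associative rings with identity, the zero ring included. *)
Definition comm1 (R : pzRingType) (a : R) : set R := [set x | x * a = a * x].

Definition comm2 (R : pzRingType) (a : R) : set R :=
  [set x | forall y, comm1 a y -> x * y = y * x].

Definition nilpotents (R : pzRingType) : set R :=
  [set x | exists n : nat, x ^+ n = 0].
Arguments nilpotents : clear implicits.

Definition is_drazin (R : pzRingType) (a b : R) : Prop :=
  [/\ b = b * a * b, comm2 a b & nilpotents R (a - a ^+ 2 * b)].

Definition drazin_elements (R : pzRingType) : set R :=
  [set a | exists b, is_drazin a b].
Arguments drazin_elements : clear implicits.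

(* The Drazin inverse a^D, with the junk value 0 outside drazin_elements R;
   by drazinP below it is the b such that is_drazin a b, if there is one. *)
Definition drazin (R : pzRingType) (a : R) : R := xget 0 (is_drazin a).

Lemma is_drazin_uniq (R : pzRingType) (a b b' : R) :
  is_drazin a b -> is_drazin a b' -> b = b'.
Proof.
have key (x y : R) : is_drazin a x -> is_drazin a y -> x = x * a * y.
  move=> [xE xC _] [yE yC [n yN]].
  have Cx : x * a = a * x by apply: xC.
  have Cy : y * a = a * y by apply: yC.
  have id2 : (a * y) * (a * y) = a * y by rewrite -mulrA [y * _]mulrA -yE.
  have aN : a ^+ n = a ^+ n * (a * y).
    have Ca : GRing.comm a (1 - a * y).
      by rewrite /GRing.comm mulrBr mulrBl mulr1 mul1r -[a * y * a]mulrA Cy.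
    move: yN; rewrite expr2 -mulrA -{1}[a]mulr1 -mulrBr exprMn_comm //.
    case: (n) => [|k]; first by rewrite !expr0 mulr1 mul1r => one0;
      rewrite -[a * y]mulr1 one0 mulr0.
    have -> : (1 - a * y) ^+ k.+1 = 1 - a * y.
      elim: k => [|k IH]; first by rewrite expr1.
      by rewrite exprS IH mulrBr mulr1 mulrBl mul1r id2 subrr subr0.
    by rewrite mulrBr mulr1 => /eqP; rewrite subr_eq0 => /eqP.
  have xn k : x = x * x ^+ k * a ^+ k.
    have xx : x * x * a = x by rewrite -mulrA Cx mulrA -xE.
    elim: k => [|k IH]; first by rewrite !expr0 !mulr1.
    rewrite [a ^+ _]exprS -[x * _]exprS !exprSr !mulrA.
    by rewrite -[_ * x * x]mulrA -[_ * (x * x) * a]mulrA xx -exprSr exprS.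
  by rewrite {1}(xn n) aN !mulrA -xn.
move=> db db'.
have [_ bC _] := db; have [_ b'C _] := db'.
have Cb : b * a = a * b by apply: bC.
have Cb' : b' * a = a * b' by apply: b'C.
have Cbb' : b * b' = b' * b by apply: bC.
transitivity (a * (b * b')); first by rewrite mulrA -Cb; exact: key.
by rewrite Cbb' mulrA -Cb'; apply/esym/key.
Qed.

Lemma drazinP (R : pzRingType) (a b : R) : is_drazin a b -> drazin a = b.
Proof.
by move=> ab; apply: xget_unique => // y ay; exact: is_drazin_uniq ay ab.
Qed.

(* Main.v *)
Require Import Defs.
From mathcomp Require Import all_boot all_algebra.
From mathcomp Require Import boolp classical_sets.

(** Put p = a c and q = b a. The hypotheses say that a b a b a, a b a c a,
    a c a b a and a c a c a coincide, that is,
      a q^2 = p^2 a,   p a q = p^2 a,   a q c a = p^2 a.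
    So a intertwines p^2 and q^2, and in the presence of one more factor p on
    the left (or q on the right) it also intertwines p and q. A Drazin inverse
    d of p satisfies d = d^2 p = p d^2 and hence supplies any number of such
    factors: d^2 a q = d a and a b d^2 = d. These two identities turn
    e = b d^2 a into an element that commutes with q and satisfies e = e q e
    and q e = b d a. Similarly a Drazin inverse g of q satisfies p a g = a q g
    and g c a = g q, and f = a g^2 c does the same for p, with p f = a g c.

    The chain conditions q^m = q^(m+1) e and p^m = p^(m+1) f come from moving
    an even power across a, with the exponents made even by [chain_even]
    ([drazin_ba_of_ac], [drazin_ac_of_ba]). That these data determine a Drazin
    inverse is [is_drazinP]: an inverse that merely commutes with its element
    already lies in the double commutant. The two formulas then follow from
    uniqueness of the Drazin inverse. *)

Import GRing.Theory.
Local Open Scope ring_scope.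

(** * Drazin inverses through the chain condition *)

(** This is the classical form of the definition. From nilpotency to the chain
    condition, the point is that 1 - a x is idempotent, so that
    a^m (1 - a x) = (a (1 - a x))^m (1 - a x). *)
Lemma is_drazin_chain (R : pzRingType) (a x : R) :
  is_drazin a x ->
  [/\ x * a = a * x, x = x * a * x & exists m, a ^+ m = a ^+ m.+1 * x].
Proof.
move=> [xE xC [m am]]; have Cx : x * a = a * x by apply: xC.
split=> //; exists m.
have Ca : GRing.comm a (1 - a * x).
  by rewrite /GRing.comm mulrBr mulrBl mulr1 mul1r -[a * x * a]mulrA Cx.
have idem : (1 - a * x) * (1 - a * x) = 1 - a * x.
  rewrite mulrBr mulr1 mulrBl mul1r.
  by rewrite -[a * x * (a * x)]mulrA [x * (a * x)]mulrA -xE subrr subr0.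
have powE : (1 - a * x) ^+ m.+1 = 1 - a * x.
  by elim: (m) => [|k IH]; rewrite ?expr1 // exprS IH.
have aE : a - a ^+ 2 * x = a * (1 - a * x).
  by rewrite mulrBr mulr1 expr2 mulrA.
apply/eqP; rewrite exprSr -mulrA -subr_eq0 -[X in X - _]mulr1 -mulrBr -powE.
by rewrite exprSr mulrA -exprMn_comm // -aE am mul0r.
Qed.

(** The double commutant comes for free: x = x^(m+1) a^m = a^m x^(m+1) and
    a^m absorbs a x on either side, so if y commutes with a, hence with a^m,
    then both x y and y x are equal to x a y x = x y a x. *)
Lemma is_drazinP (R : pzRingType) (a x : R) (m : nat) :
  x * a = a * x -> x = x * a * x -> a ^+ m = a ^+ m.+1 * x -> is_drazin a x.
Proof.
move=> Cx xE aE; split=> // [y yC|]; last first.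
  exists m.+1.
  have -> : a - a ^+ 2 * x = a * (1 - a * x).
    by rewrite mulrBr mulr1 expr2 mulrA.
  have Ca : GRing.comm a (1 - a * x).
    by rewrite /GRing.comm mulrBr mulrBl mulr1 mul1r -[a * x * a]mulrA Cx.
  rewrite exprMn_comm // [a ^+ _]exprS [(1 - a * x) ^+ _]exprS !mulrA.
  rewrite -[a * a ^+ m * _]mulrA mulrBr mulr1 [a ^+ m * (a * x)]mulrA -exprSr.
  by rewrite -aE subrr mulr0 mul0r.
have {}yC : y * a = a * y := yC.
have Cxa : GRing.comm x a := Cx.
have Cya : y * a ^+ m = a ^+ m * y by apply: commrX.
have aEl : a ^+ m = x * a * a ^+ m.
  by rewrite -mulrA -exprS [RHS](commrX m.+1 Cxa).
have aEr : a ^+ m = a ^+ m * (a * x) by rewrite mulrA -exprSr.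
have xl : x = x ^+ m.+1 * a ^+ m.
  elim: (m) => [|k IH]; first by rewrite mulr1.
  rewrite [x ^+ _]exprS [a ^+ _]exprSr mulrA -[x * _ * _]mulrA -IH.
  by rewrite -mulrA Cx mulrA.
have xr : x = a ^+ m * x ^+ m.+1.
  by rewrite {1}xl; apply: commrX; apply/commr_sym/commrX/commr_sym.
transitivity (x * y * (a * x)).
  by rewrite {1 2}xl -!(mulrA _ _ y) -!Cya {1}aEr !mulrA.
transitivity (x * a * (y * x)); last first.
  by rewrite {2 3}xr !(mulrA y) !Cya {2}aEl !mulrA.
by rewrite -!mulrA [y * (a * x)]mulrA yC !mulrA.
Qed.

(** * Exchanging the factors *)

Lemma mulX2_intertwine (R : pzRingType) (a p q : R) (k : nat) :
  a * q ^+ 2 = p ^+ 2 * a -> a * q ^+ (2 * k) = p ^+ (2 * k) * a.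
Proof.
move=> aq; elim: k => [|k IH]; first by rewrite muln0 mulr1 mul1r.
by rewrite mulnS [q ^+ _]exprD [p ^+ _]exprD mulrA aq -mulrA IH mulrA.
Qed.
Arguments mulX2_intertwine {R a p q} k.

(** Only even powers can be moved across a, so the exponent in the chain
    condition is doubled. *)
Lemma chain_even (R : pzRingType) (p d : R) (m : nat) :
  p ^+ m = p ^+ m.+1 * d -> p ^+ (2 * m) = p ^+ (2 * m) * p * d.
Proof.
by move=> pm; rewrite mul2n -addnn exprD {2}pm exprSr !mulrA.
Qed.

(** For c = b the hypotheses hold trivially and this is Cline's formula, whose
    proof rests on a q = p a for p = a c and q = b a. In general this identity
    is available only next to another factor p, and d supplies such factors
    through d = d^2 p = p d^2. *)
Lemma drazin_ba_of_ac (R : pzRingType) (a b c d : R) :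
  a * (b * a) ^+ 2 = (a * c) ^+ 2 * a ->
  a * c * a * (b * a) = (a * c) ^+ 2 * a ->
  a * b * (a * c) * a = (a * c) ^+ 2 * a ->
  is_drazin (a * c) d -> is_drazin (b * a) (b * d ^+ 2 * a).
Proof.
move=> aqq paq abp /is_drazin_chain[Cd dE [m /chain_even pm]].
(* Opaque names keep rewriting with associativity from splitting p and q. *)
have [[p pE] [q qE]] : (exists p, p = a * c) /\ (exists q, q = b * a).
  by split; eexists.
rewrite -?pE -?qE in aqq paq abp Cd dE pm *.
have pdd : p * (d * d) = d by rewrite mulrA -Cd -dE.
have pddM z : p * (d * (d * z)) = d * z by rewrite (mulrA d) mulrA pdd.
have ddp : d * (d * p) = d by rewrite Cd mulrA -dE.
have ddpM z : d * (d * (p * z)) = d * z by rewrite (mulrA d p) mulrA ddp.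
(* Write d^2 = p^2 d^4 and split the second p, so that a b p a occurs. *)
have abdd : a * b * d ^+ 2 = d.
  have -> : d ^+ 2 = p * (a * (c * (d * (d * (d * d))))).
    by rewrite (mulrA a) -pE !pddM expr2.
  rewrite (mulrA p) (mulrA (a * b)) (mulrA (a * b)) abp -mulrA.
  by rewrite (mulrA a) -pE expr2 -mulrA !pddM pdd.
have abd : a * b * d = d * p.
  by rewrite -{1}ddp (mulrA d d) -expr2 mulrA abdd.
have ddaq : d ^+ 2 * a * q = d * a.
  have -> : d ^+ 2 = d * d * (d * p) by rewrite -mulrA ddp expr2.
  by rewrite -!mulrA (mulrA p) paq expr2 -mulrA !ddpM.
have eq : b * d ^+ 2 * a * q = b * d * a by rewrite -!(mulrA b) ddaq.
have qe : q * (b * d ^+ 2 * a) = b * d * a.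
  by rewrite qE -!(mulrA b) (mulrA a b) (mulrA (a * b)) abdd.
apply: (@is_drazinP _ _ _ (2 * m).+1); first by rewrite eq qe.
  rewrite eq -!(mulrA b) -(mulrA d) (mulrA a b) (mulrA (a * b)) abdd.
  by rewrite (mulrA d) -expr2.
have qX : q ^+ (2 * m).+1 = b * (p ^+ (2 * m) * a).
  by rewrite exprS {1}qE -mulrA (mulX2_intertwine _ aqq).
rewrite [q ^+ _.+2]exprSr -[RHS]mulrA qe qX.
rewrite -(mulrA b (_ * a)) -(mulrA _ a) -(mulrA b d).
by rewrite (mulrA a b) (mulrA (a * b)) abd Cd {1}pm -!mulrA.
Qed.

(** The converse direction extracts the spare factors q from g = g^2 q = q g^2.
    The third hypothesis makes c a indistinguishable from q to the right of g,
    which lets p = a c act on a g^2 c from the right. *)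
Lemma drazin_ac_of_ba (R : pzRingType) (a b c g : R) :
  a * (b * a) ^+ 2 = (a * c) ^+ 2 * a ->
  a * c * a * (b * a) = (a * c) ^+ 2 * a ->
  a * (b * a) * (c * a) = (a * c) ^+ 2 * a ->
  is_drazin (b * a) g -> is_drazin (a * c) (a * g ^+ 2 * c).
Proof.
move=> aqq paq aqca /is_drazin_chain[Cg gE [m /chain_even qm]].
have [[p pE] [q qE]] : (exists p, p = a * c) /\ (exists q, q = b * a).
  by split; eexists.
rewrite -?pE -?qE in aqq paq aqca Cg gE qm *.
have qgg : q * (g * g) = g by rewrite mulrA -Cg -gE.
have ggq : g * (g * q) = g by rewrite Cg mulrA -gE.
(* Write g = g^3 q^2; then q^2 c a = b (a q c a) = b (a q^2) = q^3. *)
have gca : g * (c * a) = g * q.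
  have qqca : q * (q * (c * a)) = q * (q * q).
    by rewrite {1 3}qE -!(mulrA b) (mulrA a) aqca -aqq expr2.
  have gq : g * (g * (g * (q * q))) = g.
    by rewrite (mulrA g q) (mulrA g (g * q)) ggq.
  by rewrite -{1}gq -!mulrA qqca -[in RHS]gq -!mulrA.
have pag : p * a * g = a * q * g.
  by rewrite -{1}qgg mulrA paq -aqq expr2 -!mulrA qgg.
have pf : p * (a * g ^+ 2 * c) = a * g * c.
  by rewrite expr2 !mulrA pag -!mulrA (mulrA g g) (mulrA q) qgg.
have fp : a * g ^+ 2 * c * p = a * g * c.
  by rewrite pE expr2 -!mulrA (mulrA c) (mulrA g (c * a)) gca (mulrA g) ggq.
apply: (@is_drazinP _ _ _ (2 * m).+1); first by rewrite pf fp.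
  rewrite fp expr2 -!mulrA (mulrA c a) (mulrA g (c * a)) gca.
  by rewrite -!mulrA (mulrA g g c) (mulrA q) qgg -mulrA.
have pX : p ^+ (2 * m).+1 = a * q ^+ (2 * m) * c.
  by rewrite exprSr {2}pE mulrA (mulX2_intertwine _ aqq).
rewrite [p ^+ _.+2]exprSr -[RHS]mulrA pf {1}pX {1}qm exprSr.
rewrite -!mulrA (mulrA p) (mulrA (p * a)) pag.
by rewrite -!mulrA (mulrA (p ^+ _)) -(mulX2_intertwine _ aqq) -!mulrA.
Qed.

Theorem theorem2p7 (R : pzRingType) (a b c : R)
    (h1 : a * (b * a) ^+ 2 = a * b * a * c * a)
    (h2 : a * b * a * c * a = a * c * a * b * a)
    (h3 : a * c * a * b * a = (a * c) ^+ 2 * a) :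
  (drazin_elements R (a * c) <-> drazin_elements R (b * a)) /\
  (drazin_elements R (a * c) ->
     drazin (b * a) = b * drazin (a * c) ^+ 2 * a /\
     drazin (a * c) = a * drazin (b * a) ^+ 2 * c).
Proof.
have aqq : a * (b * a) ^+ 2 = (a * c) ^+ 2 * a by rewrite h1 h2.
have paq : a * c * a * (b * a) = (a * c) ^+ 2 * a by rewrite mulrA.
have abp : a * b * (a * c) * a = (a * c) ^+ 2 * a by rewrite mulrA h2.
have aqca : a * (b * a) * (c * a) = (a * c) ^+ 2 * a by rewrite !mulrA h2.
have to_ba d := @drazin_ba_of_ac R a b c d aqq paq abp.
have to_ac g := @drazin_ac_of_ba R a b c g aqq paq aqca.
split=> [|[d dP]]; first by split=> -[x xP]; eexists; eauto.
have eP := to_ba _ dP.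
rewrite (drazinP dP) (drazinP eP); split=> //.
exact: is_drazin_uniq dP (to_ac _ eP).
Qed.
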